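(* Let $\mathcal{H}$ be a separable Hilbert space, let $\{f_i\}_{i\in I}$ be a frame for $\mathcal{H}$ with frame operator $S$ and frame bounds $A\leqslant B$, and let $L:\mathcal{H}\to\mathcal{H}$ be a bounded linear operator. Then $\{f_i+Lf_i\}_{i\in I}$ is a frame for $\mathcal{H}$ if and only if $\mathrm{Id}+L$ is surjective. Moreover, in this case the frame operator for the new frame is $(\mathrm{Id}+L)S(\mathrm{Id}+L^* )$, and $A\|(\mathrm{Id}+L)^{\dagger}\|^{-2}$ and $B\|\mathrm{Id}+L\|^2$ are (lower and upper, respectively) frame bounds for it, where $(\mathrm{Id}+L)^{\dagger}$ is the pseudo-inverse of $\mathrm{Id}+L$. In particular, if $L$ is a positive operator (or just $L>-\mathrm{Id}$, meaning that $L$ is self-adjoint and there is $\varepsilon>0$ with $\langle (\mathrm{Id}+L)f,f\rangle\geqslant\varepsilon\|f\|^2$ for all $f\in\mathcal{H}$), then $\{f_i+Lf_i\}_{i\in I}$ is a frame for $\mathcal{H}$ with frame operator $S+LS+SL^*+LSL^*$.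
   Context: The index set $I$ is countable and $\mathrm{Id}$ is the identity operator on $\mathcal{H}$. A sequence $\{f_i\}_{i\in I}\subseteq\mathcal{H}$ is a frame for $\mathcal{H}$ if there exist constants $0<A\leqslant B<\infty$ such that $A\|f\|^2\leqslant\sum_{i\in I}|\langle f,f_i\rangle|^2\leqslant B\|f\|^2$ for all $f\in\mathcal{H}$; such constants $A$ and $B$ are called a lower and an upper frame bound. The frame operator of a frame $\{f_i\}_{i\in I}$ is the bounded, positive, invertible operator $S:\mathcal{H}\to\mathcal{H}$, $Sf=\sum_{i\in I}\langle f,f_i\rangle f_i$. A positive operator is a self-adjoint bounded operator $L$ with $\langle Lf,f\rangle\geqslant 0$ for all $f$. The pseudo-inverse $M^\dagger$ of a bounded operator $M$ with closed range is the (Moore–Penrose) bounded operator on $\mathcal{H}$ with $MM^\dagger f=f$ for $f$ in the range of $M$, kernel of $M^\dagger$ equal to the orthogonal complement of the range of $M$, and range of $M^\dagger$ equal to the orthogonal complement of the kernel of $M$. *)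

(* Defs.v *)
From mathcomp Require Import all_boot all_order all_algebra finmap.
From mathcomp Require Import complex.
From mathcomp Require Import all_classical all_reals all_analysis.
From mathcomp Require Import summability.

Set Implicit Arguments.
Unset Strict Implicit.
Unset Printing Implicit Defensive.

Import Order.TTheory GRing.Theory Num.Theory.
Import numFieldNormedType.Exports.

Local Open Scope classical_set_scope.
Local Open Scope ring_scope.

(* Hilbert spaces are taken over the real or over the complex numbers. *)
Variant scalar_kind := RealScalars | ComplexScalars.

Definition scalar_field (R : realType) (k : scalar_kind) : numFieldType :=
  match k with
  | RealScalars => R
  | ComplexScalars => R[i]
  end.

Definition conj_scalar (R : realType) (k : scalar_kind) :
    scalar_field R k -> scalar_field R k :=
  match k with
  | RealScalars => idfun
  | ComplexScalars => fun z : R[i] => z^*%C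
  end.

(* In the complex case norms are elements of R[i]; [re_scalar] brings them
   back to R, where suprema and extended-real sums are available. *)
Definition re_scalar (R : realType) (k : scalar_kind) :
    scalar_field R k -> R :=
  match k with
  | RealScalars => idfun
  | ComplexScalars => @complex.Re R
  end.

Arguments conj_scalar {R k}.
Arguments re_scalar {R k}.

Definition separable_space (T : topologicalType) :=
  exists D : set T, countable D /\ dense D.

Section Hilbert.
Variables (R : realType) (k : scalar_kind).
Variable H : completeNormedModType (scalar_field R k).
(* Linear in the first argument, conjugate-linear in the second. *)
Variable ip : {dot H for @conj_scalar R k}.

(* With this, [H] is a Hilbert space: completeness is part of its type. *)
Definition induces_norm := forall x : H, `|x| ^+ 2 = ip x x.

Definition bounded_op (T : H -> H) :=
  exists M : scalar_field R k, forall x, `|T x| <= M * `|x|.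

(* Meaningful when [bounded_op T] holds; otherwise the supremum is 0. *)
Definition opnorm (T : H -> H) : R :=
  sup [set re_scalar `|T x| | x in [set x : H | `|x| <= 1]].

(* For bounded linear [T] the vector [z] exists (Riesz) and is unique. *)
Definition adjoint (T : H -> H) (y : H) : H :=
  xget 0 [set z | forall x, ip (T x) y = ip x z].

Definition self_adjoint (T : H -> H) := adjoint T = T.

Definition positive_op (T : {linear H -> H}) :=
  [/\ bounded_op T, self_adjoint T & forall x, 0 <= ip (T x) x].

(* In [scalar_field R ComplexScalars], [0 < e] entails that [e] is real, and
   [a <= b] that [b - a] is real. *)
Definition gt_negId (T : {linear H -> H}) :=
  self_adjoint T /\
  exists e : scalar_field R k,
    0 < e /\ forall x : H, e * `|x| ^+ 2 <= ip (x + T x) x.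

Definition orthocompl (E : set H) : set H :=
  [set x | forall y, E y -> ip x y = 0].

Definition kernel_op (T : H -> H) : set H := [set x | T x = 0].

Definition is_pseudo_inverse (M P : H -> H) :=
  [/\ linear P, bounded_op P,
      forall y, range M y -> M (P y) = y,
      kernel_op P = orthocompl (range M)
    & range P = orthocompl (kernel_op M)].

(* There is exactly one such [P] when [M] is linear and bounded with closed
   range. *)
Definition pseudo_inverse (M : H -> H) : H -> H :=
  xget (fun=> 0) [set P | is_pseudo_inverse M P].

Section Frames.
Variable I : countType.

Definition frame_bounds (f : I -> H) (A B : R) :=
  [/\ 0 < A, A <= B &
    forall x : H,
      ((A * re_scalar `|x| ^+ 2)%:E
        <= \esum_(i in [set: I]) (re_scalar `|ip x (f i)| ^+ 2)%:E
        <= (B * re_scalar `|x| ^+ 2)%:E)%E].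

Definition is_frame (f : I -> H) := exists A B, frame_bounds f A B.

(* Sums in H are limits of finite partial sums along the directed set of
   finite subsets of I (unconditional convergence).  When the family is not
   summable, [sum] is a junk value, which [is_frame_operator] excludes. *)
Definition frame_operator (f : I -> H) (x : H) : H :=
  sum (fun i => ip x (f i) *: f i).

Definition is_frame_operator (f : I -> H) (U : H -> H) :=
  forall x, partial_sum (fun i => ip x (f i) *: f i) @ totally --> U x.

End Frames.
End Hilbert.

(* Main.v *)
(* With T = Id + L one has <x, T f_i> = <T^* x, f_i>, so the coefficients of x
   with respect to the new family are the old ones of T^* x.  Hence the new
   frame operator is T S T^*, the upper bound is B |T^*|^2, and the new family
   is a frame iff T^* is bounded below, i.e. iff T is onto.  If T is onto, T^* is
   bounded below by uniform boundedness; quantitatively, T T^+ = Id gives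
   |x|^2 = <T^+ x, T^* x> <= |T^+| |x| |T^* x|.  If T^* is bounded below, T T^*
   is coercive, hence onto by the Lax-Milgram iteration.  The same iteration
   inverts S, and the frame then yields Riesz representation, and thereby
   adjoints, without orthogonal projections. *)

From HB Require Import structures.
Require Import Defs.
From mathcomp Require Import all_boot all_order all_algebra.
From mathcomp Require Import finmap complex ring lra.
From mathcomp Require Import all_classical all_reals all_analysis.
From mathcomp Require Import summability.

Set Implicit Arguments.
Unset Strict Implicit.
Unset Printing Implicit Defensive.

Import Order.TTheory GRing.Theory Num.Theory.
Import numFieldNormedType.Exports.

Local Open Scope classical_set_scope.
Local Open Scope ring_scope.

(** * Real and complex scalars *)

(** A ring morphism with left inverse [re_scalar] that preserves and reflects order: estimates are
    carried out in [R], where suprema, square roots and [lra] are at hand, and then transported to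
    the scalars. *)
Definition of_real (R : realType) (k : scalar_kind) : R -> scalar_field R k :=
  match k with
  | RealScalars => idfun
  | ComplexScalars => real_complex R
  end.

Section ScalarTheory.
Variables (R : realType) (k : scalar_kind).
Local Notation K := (scalar_field R k).
Implicit Types (r s : R) (z w : K).

Lemma of_real_is_zmod_morphism : zmod_morphism (@of_real R k).
Proof. by case: k => //= x y; rewrite rmorphB. Qed.

Lemma of_real_is_monoid_morphism : monoid_morphism (@of_real R k).
Proof. by case: k => //=; split=> // x y; rewrite rmorphM. Qed.

HB.instance Definition _ :=
  GRing.isZmodMorphism.Build R K (@of_real R k) of_real_is_zmod_morphism.
HB.instance Definition _ :=
  GRing.isMonoidMorphism.Build R K (@of_real R k) of_real_is_monoid_morphism.

Lemma conj_scalar_is_zmod_morphism : zmod_morphism (@conj_scalar R k).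
Proof. by case: k => //= x y; rewrite /conj_scalar rmorphB. Qed.

Lemma conj_scalar_is_monoid_morphism : monoid_morphism (@conj_scalar R k).
Proof.
by case: k => //=; split=> [|x y]; rewrite /conj_scalar ?rmorph1 ?rmorphM.
Qed.

HB.instance Definition _ := GRing.isZmodMorphism.Build K K
  (@conj_scalar R k) conj_scalar_is_zmod_morphism.
HB.instance Definition _ := GRing.isMonoidMorphism.Build K K
  (@conj_scalar R k) conj_scalar_is_monoid_morphism.

Lemma re_scalar_is_zmod_morphism : zmod_morphism (@re_scalar R k).
Proof. by case: k => //= x y; rewrite /re_scalar raddfB. Qed.

HB.instance Definition _ := GRing.isZmodMorphism.Build K R
  (@re_scalar R k) re_scalar_is_zmod_morphism.

Lemma of_realK : cancel (@of_real R k) re_scalar.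
Proof. by case: k. Qed.

Lemma re_scalarK z : 0 <= z -> of_real k (re_scalar z) = z.
Proof. by case: k z => [//|[a b]]; rewrite lecE /= => /andP[/eqP->]. Qed.

Lemma ler_of_real r s : (of_real k r <= of_real k s) = (r <= s).
Proof. by case: k => //=; rewrite lecR. Qed.

Lemma ler_re_scalar z w : z <= w -> re_scalar z <= re_scalar w.
Proof. by case: k z w => [z w //|[a b] [c d]]; rewrite lecE => /andP[]. Qed.

Lemma re_scalar_ofM r z : re_scalar (of_real k r * z) = r * re_scalar z.
Proof. by case: k z => [//|[a b]] /=; rewrite mul0r subr0. Qed.

Lemma re_scalar_conj z : re_scalar (conj_scalar z) = re_scalar z.
Proof. by case: k z => [//|[]]. Qed.

Lemma conj_scalarK : involutive (@conj_scalar R k).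
Proof. by case: k => [//|[a b]]; rewrite /conj_scalar /= opprK. Qed.

Lemma conj_of_real r : conj_scalar (of_real k r) = of_real k r.
Proof. by case: k => //=; rewrite /conj_scalar /= oppr0. Qed.

Lemma normr_sqr_scalar z : `|z| ^+ 2 = z * conj_scalar z.
Proof.
case: k z => [|] z /=; first by rewrite real_normK // num_real.
by rewrite sqr_normc.
Qed.

End ScalarTheory.

(** * Norms with values in [R], completeness and geometric convergence *)

Definition rnorm (R : realType) (k : scalar_kind)
  (V : normedModType (scalar_field R k)) (x : V) : R := re_scalar `|x|.

Section RealNorm.
Variables (R : realType) (k : scalar_kind).
Local Notation K := (scalar_field R k).
Implicit Types V : normedModType K.

Lemma of_rnorm V (x : V) : of_real k (rnorm x) = `|x|.
Proof. by rewrite re_scalarK. Qed.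

Lemma rnorm_ge0 V (x : V) : 0 <= rnorm x.
Proof. by rewrite -(ler_of_real k) of_rnorm rmorph0. Qed.

Lemma rnorm0 V : rnorm (0 : V) = 0.
Proof. by rewrite /rnorm normr0 raddf0. Qed.

Lemma rnorm_eq0 V (x : V) : (rnorm x == 0) = (x == 0).
Proof. by rewrite -(fmorph_eq0 (of_real k)) /= of_rnorm normr_eq0. Qed.

Lemma rnormN V (x : V) : rnorm (- x) = rnorm x.
Proof. by rewrite /rnorm normrN. Qed.

Lemma rnormD V (x y : V) : rnorm (x + y) <= rnorm x + rnorm y.
Proof. by rewrite -(ler_of_real k) rmorphD /= !of_rnorm ler_normD. Qed.

Lemma rnormZ V (a : K) (x : V) : rnorm (a *: x) = rnorm a * rnorm x.
Proof.
by apply: (fmorph_inj (of_real k)); rewrite rmorphM /= !of_rnorm normrZ.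
Qed.

Lemma rnormM (a b : K) : rnorm (a * b) = rnorm a * rnorm b.
Proof. exact: rnormZ. Qed.

Lemma rnorm_of_real (r : R) : 0 <= r -> rnorm (of_real k r) = r.
Proof.
by move=> r0; rewrite /rnorm ger0_norm ?of_realK// -(rmorph0 (of_real k)) ler_of_real.
Qed.

Lemma ltr_of_rnorm V (x : V) (e : R) : (`|x| < of_real k e) = (rnorm x < e).
Proof.
rewrite !lt_neqAle -(ler_of_real k) -(inj_eq (fmorph_inj (of_real k))) /=.
by rewrite of_rnorm.
Qed.

Lemma rnorm_sqr_scalar (z : K) : of_real k (rnorm z ^+ 2) = z * conj_scalar z.
Proof. by rewrite rmorphXn /= of_rnorm normr_sqr_scalar. Qed.

Lemma rnorm_conj (z : K) : rnorm (conj_scalar z) = rnorm z.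
Proof.
apply/eqP; rewrite -(eqrXn2 (n := 2)) ?rnorm_ge0//; apply/eqP.
by apply: (fmorph_inj (of_real k)); rewrite /= !rnorm_sqr_scalar conj_scalarK mulrC.
Qed.

Lemma ler_re_rnorm (z : K) : `|re_scalar z| <= rnorm z.
Proof.
rewrite /rnorm; case: k z => [//|z].
by have := ler_re_scalar (k := ComplexScalars) (normc_ge_Re z).
Qed.

Lemma re_scalar_gt0 (e : K) : 0 < e -> 0 < re_scalar e.
Proof.
move=> e0; have e_re : of_real k (re_scalar e) = e by rewrite re_scalarK// ltW.
rewrite lt_def -(fmorph_eq0 (of_real k)) /= e_re gt_eqF//=.
by rewrite -(ler_of_real k) e_re rmorph0 ltW.
Qed.

(** A positive scalar is the image of a positive real, even over the complex numbers, so real radii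
    suffice. *)
Lemma cvg_rnormP V (T : Type) (F : set_system T) {FF : Filter F}
    (u : T -> V) (l : V) :
  u @ F --> l <->
  forall e : R, 0 < e -> \forall t \near F, rnorm (l - u t) < e.
Proof.
split=> [/cvgrPdist_lt ul e e0|ul].
  have /ul : 0 < of_real k e.
    by rewrite lt_def fmorph_eq0 gt_eqF//= -(rmorph0 (of_real k)) ler_of_real ltW.
  by apply: filterS => t; rewrite ltr_of_rnorm.
apply/cvgrPdist_lt => e e0.
have e_re : of_real k (re_scalar e) = e by rewrite re_scalarK// ltW.
have re0 := re_scalar_gt0 e0.
by apply: filterS (ul _ re0) => t; rewrite -ltr_of_rnorm e_re.
Qed.

Lemma rnorm_cvg (V : completeNormedModType K) (T : Type) (F : set_system T)
    {FF : ProperFilter F} (u : T -> V) :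
  (forall e : R, 0 < e -> exists x, \forall t \near F, rnorm (x - u t) < e) ->
  cvg (u @ F).
Proof.
move=> cu; apply: cauchy_cvg; apply: cauchy_exP => e e0.
have e_re : of_real k (re_scalar e) = e by rewrite re_scalarK// ltW.
have re0 := re_scalar_gt0 e0.
have [x xu] := cu _ re0; exists x; rewrite /fmapE -ball_normE.
by apply: filterS xu => t /=; rewrite -ltr_of_rnorm e_re.
Qed.

Lemma rnorm_small_eq0 V (x : V) :
  (forall e : R, 0 < e -> rnorm x <= e) -> x = 0.
Proof.
move=> small; apply/eqP; rewrite -rnorm_eq0; apply/eqP/le_anti.
rewrite rnorm_ge0 andbT; apply/ler_addgt0Pr => e e0; rewrite add0r; exact: small.
Qed.

Lemma geometric_small (C q e : R) : 0 <= q -> q < 1 -> 0 < e ->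
  exists n, C * q ^+ n < e.
Proof.
move=> q0 q1 e0.
have : (fun n => C * q ^+ n) @ \oo --> (C * 0 : R).
  by apply: cvgMr; apply: cvg_expr; rewrite ger0_norm.
rewrite mulr0 => /cvgrPdist_lt /(_ e e0) [n _ /(_ n (leqnn n))] /=.
by rewrite sub0r normrN => /(le_lt_trans (ler_norm _)) Ce; exists n.
Qed.

(** The explicit rate, the tail of the geometric series, is what both the Lax-Milgram iteration and
    the uniform boundedness argument consume. *)
Lemma geometric_cvg (V : completeNormedModType K) (u : nat -> V) (C q : R) :
  0 <= q < 1 -> (forall n, rnorm (u n.+1 - u n) <= C * q ^+ n) ->
  exists l, forall n, rnorm (l - u n) <= C * q ^+ n / (1 - q).
Proof.
move=> /andP[q0 q1] uC.
have q1' : 0 < 1 - q by rewrite subr_gt0.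
have C0 : 0 <= C.
  by have := uC 0%N; rewrite expr0 mulr1; apply: le_trans (rnorm_ge0 _).
(* The factor [1 - q ^+ m] is the exact finite geometric sum; it makes the induction on [m] close
   with an equality and is then dropped. *)
have dist n m : rnorm (u (n + m)%N - u n) <= C * q ^+ n / (1 - q) * (1 - q ^+ m).
  elim: m => [|m IHm]; first by rewrite addn0 subrr rnorm0 expr0 subrr mulr0.
  rewrite addnS -(subrK (u (n + m)%N) (u (n + m).+1)) -addrA.
  apply: le_trans (rnormD _ _) _; apply: le_trans (lerD (uC _) IHm) _.
  by rewrite exprS exprD le_eqVlt; apply/orP; left; apply/eqP; field; rewrite gt_eqF.
have dist_le n m : rnorm (u (n + m)%N - u n) <= C * q ^+ n / (1 - q).
  apply: le_trans (dist n m) _; apply: ler_piMr.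
    by rewrite divr_ge0 ?mulr_ge0 ?exprn_ge0// ltW.
  by rewrite gerBl exprn_ge0.
have dist_small e : 0 < e -> exists n, C * q ^+ n / (1 - q) < e.
  move=> e0; have [n ne] := geometric_small (C / (1 - q)) q0 q1 e0.
  by exists n; rewrite mulrAC.
have cu : cvg (u @ \oo).
  apply: rnorm_cvg => e e0; have [n ne] := dist_small e e0.
  exists (u n), n => // m /= nm.
  by rewrite -opprB rnormN -(subnKC nm) (le_lt_trans (dist_le _ _)).
exists (lim (u @ \oo)) => n; apply/ler_addgt0Pr => e e0.
have /cvg_rnormP /(_ e e0) [N _ uN] := cu.
have := uN _ (leq_addl n N).
have -> : lim (u @ \oo) - u n =
    (lim (u @ \oo) - u (n + N)%N) + (u (n + N)%N - u n).
  by rewrite addrA subrK.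
move=> /ltW lN; apply: le_trans (rnormD _ _) _.
by rewrite addrC lerD.
Qed.

End RealNorm.

(** * Hilbert spaces *)

Section InnerProduct.
Variables (R : realType) (k : scalar_kind).
Local Notation K := (scalar_field R k).
Variable H : completeNormedModType K.
Variable ip : {dot H for @conj_scalar R k}.
Hypothesis ip_norm : induces_norm ip.
Implicit Types x y u z : H.

Lemma ipC x y : ip x y = conj_scalar (ip y x).
Proof. by rewrite hermC expr0 mul1r. Qed.

Lemma re_ipC x y : re_scalar (ip x y) = re_scalar (ip y x).
Proof. by rewrite ipC re_scalar_conj. Qed.

Lemma ipZl (a : K) x y : ip (a *: x) y = a * ip x y.
Proof. exact: linearZl_LR. Qed.

Lemma ipZr (a : K) x y : ip x (a *: y) = conj_scalar a * ip x y.
Proof. exact: linearZr_LR. Qed.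

Lemma ipDl x y z : ip (x + y) z = ip x z + ip y z.
Proof. exact: linearDl. Qed.

Lemma ipDr x y z : ip x (y + z) = ip x y + ip x z.
Proof. exact: linearDr. Qed.

Lemma ipBl x y z : ip (x - y) z = ip x z - ip y z.
Proof. exact: linearBl. Qed.

Lemma ipBr x y z : ip x (y - z) = ip x y - ip x z.
Proof. exact: linearBr. Qed.

Lemma ipxx x : ip x x = of_real k (rnorm x ^+ 2).
Proof. by rewrite -ip_norm rmorphXn /= of_rnorm. Qed.

Lemma rnormD_sqr x y :
  rnorm (x + y) ^+ 2 = rnorm x ^+ 2 + rnorm y ^+ 2 + 2 * re_scalar (ip x y).
Proof.
rewrite -[LHS](of_realK k) -ipxx ipDl !ipDr !raddfD /= (re_ipC y x).
by rewrite !ipxx !of_realK; ring.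
Qed.

(** Up to the factor [rnorm y ^+ 2], the vector [of_real k b *: x - a *: y] is the component of [x]
    orthogonal to [y]; its squared norm is nonnegative, and this form avoids division. *)
Lemma cauchy_schwarz x y : rnorm (ip x y) <= rnorm x * rnorm y.
Proof.
have [->|y0] := eqVneq y 0; first by rewrite linear0r !rnorm0 mulr0.
have ny : 0 < rnorm y by rewrite lt_def rnorm_eq0 y0 rnorm_ge0.
pose a := ip x y; pose b := rnorm y ^+ 2.
have b0 : 0 < b by rewrite exprn_gt0.
have : rnorm (of_real k b *: x - a *: y) ^+ 2 =
    b * (b * rnorm x ^+ 2 - rnorm a ^+ 2).
  apply: (fmorph_inj (of_real k)) => /=.
  rewrite -ipxx ipBl !ipBr !ipZl !ipZr conj_of_real (ipC y x) !ipxx.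
  have := rnorm_sqr_scalar a; rewrite -/a -/b.
  move: (rnorm x ^+ 2) (rnorm a ^+ 2) => x2 a2 a2E.
  by rewrite !(rmorphM, rmorphB) /= a2E; ring.
move=> eq_b; have : 0 <= b * (b * rnorm x ^+ 2 - rnorm a ^+ 2).
  by rewrite -eq_b sqr_ge0.
rewrite pmulr_rge0// subr_ge0 mulrC -exprMn ler_pXn2r// nnegrE ?mulr_ge0 //.
all: exact: rnorm_ge0.
Qed.

Lemma ip_injr u v : (forall x, ip x u = ip x v) -> u = v.
Proof.
move=> uv; apply/eqP; rewrite -subr_eq0 -rnorm_eq0 -sqrf_eq0.
by rewrite -(fmorph_eq0 (of_real k)) /= -ipxx ipBr uv subrr.
Qed.

(* Iterate [x |-> x + t (y - T x)] with [t = c / N ^+ 2], where [N] bounds the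
   norm of [T]: the residual [y - T x] shrinks by the factor
   [sqrt (1 - (c / N) ^+ 2)] at each step. *)
Lemma lax_milgram (T : {linear H -> H}) (M c : R) : 0 < c ->
  (forall x, rnorm (T x) <= M * rnorm x) ->
  (forall x, c * rnorm x ^+ 2 <= re_scalar (ip (T x) x)) ->
  forall y, exists x, T x = y.
Proof.
(* Adding [c] makes [N] positive and gives [c / N <= 1], so the number under the square root in [q]
   is nonnegative. *)
move=> c0 TM Tc y; pose N := `|M| + c.
have N0 : 0 < N by rewrite ltr_wpDl.
have TN x : rnorm (T x) <= N * rnorm x.
  apply: le_trans (TM x) _; rewrite ler_wpM2r ?rnorm_ge0//.
  by rewrite (le_trans (ler_norm M))// lerDl ltW.
pose t := c / N ^+ 2; pose q2 := 1 - (c / N) ^+ 2; pose q := Num.sqrt q2.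
have q2ge0 : 0 <= q2.
  rewrite subr_ge0 exprn_ile1//; first by rewrite divr_ge0// ltW.
  by rewrite ler_pdivrMr// mul1r lerDr.
have q2lt1 : q2 < 1 by rewrite gtrBl exprn_gt0// divr_gt0.
have q0 : 0 <= q by exact: sqrtr_ge0.
have q1 : q < 1 by rewrite -(sqrtr1 R) ltr_sqrt.
have t0 : 0 <= t by rewrite divr_ge0 ?sqr_ge0// ltW.
(* Expanding the square gives the factor [1 - 2 * t * c + t ^+ 2 * N ^+ 2]; the choice
   [t = c / N ^+ 2] minimises it, with value [q2]. *)
have contr r : rnorm (r - of_real k t *: T r) <= q * rnorm r.
  rewrite -(@ler_pXn2r _ 2)// ?nnegrE ?mulr_ge0 ?rnorm_ge0//.
  rewrite exprMn sqr_sqrtr// rnormD_sqr rnormN rnormZ linearNr raddfN /=.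
  rewrite re_ipC ipZl re_scalar_ofM rnorm_of_real//.
  have := Tc r; have : rnorm (T r) ^+ 2 <= N ^+ 2 * rnorm r ^+ 2.
    by rewrite -exprMn ler_pXn2r// ?nnegrE ?mulr_ge0 ?rnorm_ge0// ltW.
  move=> /(ler_wpM2l (sqr_ge0 t)) h1 /(ler_wpM2l t0) h2.
  have -> : q2 = 1 + t ^+ 2 * N ^+ 2 - 2 * (t * c).
    by rewrite /q2 /t; field; rewrite gt_eqF.
  by rewrite exprMn; lra.
pose u := fix u n := if n is m.+1 then u m + of_real k t *: (y - T (u m)) else 0 : H.
(* With [r] the residual at [u n], the residual at [u n.+1] is [r - of_real k t *: T r], to which
   [contr] applies. *)
have res n : rnorm (y - T (u n)) <= rnorm y * q ^+ n.
  elim: n => [|n IHn]; first by rewrite /= linear0 subr0 expr0 mulr1.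
  rewrite /= linearD linearZ /= opprD addrA; apply: le_trans (contr _) _.
  by rewrite exprS mulrCA ler_wpM2l.
have step n : rnorm (u n.+1 - u n) <= (t * rnorm y) * q ^+ n.
  by rewrite /= [u n + _]addrC addrK rnormZ rnorm_of_real// -mulrA ler_wpM2l.
have [|l ul] := geometric_cvg _ step; first by rewrite q0.
exists l; apply/eqP; rewrite -subr_eq0; apply/eqP.
(* The first summand accounts for [T (l - u n)], the second for the residual at [u n]. *)
pose D := N * (t * rnorm y / (1 - q)) + rnorm y.
have D0 : 0 <= D.
  rewrite addr_ge0 ?rnorm_ge0// mulr_ge0 ?(ltW N0)//.
  have ty : 0 <= t * rnorm y by rewrite mulr_ge0// rnorm_ge0.
  by rewrite divr_ge0// subr_ge0 ltW.
have resD n : rnorm (T l - y) <= D * q ^+ n.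
  rewrite (_ : T l - y = T (l - u n) - (y - T (u n))); last first.
    by rewrite linearB opprB addrA subrK.
  apply: le_trans (rnormD _ _) _; rewrite rnormN mulrDl lerD ?res//.
  apply: le_trans (TN _) _; rewrite -mulrA ler_wpM2l ?(ltW N0)//.
  by rewrite mulrAC; exact: ul.
apply: rnorm_small_eq0 => e e0.
have [n De] := geometric_small D q0 q1 e0.
by rewrite (le_trans (resD n))// ltW.
Qed.

(* Sokal's argument, without Baire: if [rnorm (v n) > 4 ^+ n], walk by steps
   [+/- w n] of length [3 ^- n] along [v n], with the sign that makes
   [rnorm (ip x (v n)) >= 3 ^- n * rnorm (v n)]; the later steps sum to at most
   half of that length, so [ip l (v n)] is unbounded at the limit [l]. *)
Lemma uniform_boundedness (F : set H) :
  (forall y, exists C, forall u, F u -> rnorm (ip y u) <= C) ->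
  exists C, forall u, F u -> rnorm u <= C.
Proof.
move=> ptwise; apply: contrapT => unbounded.
have /choice[v vP] (n : nat) : exists u, F u /\ 4 ^+ n < rnorm u.
  apply: contrapT => nu; apply: unbounded; exists (4 ^+ n) => u Fu.
  by rewrite leNgt; apply/negP => u4; apply: nu; exists u.
have v0 n : 0 < rnorm (v n) by rewrite (lt_trans _ (vP n).2)// exprn_gt0.
pose q : R := 3^-1.
have q0 : 0 <= q by rewrite invr_ge0.
have q1 : q < 1 by rewrite invf_lt1// ltr1n.
pose w n := of_real k (q ^+ n / rnorm (v n)) *: v n.
have normw n : rnorm (w n) = q ^+ n.
  rewrite rnormZ rnorm_of_real; last by rewrite divr_ge0 ?exprn_ge0// ltW.
  by rewrite divfK// gt_eqF.
have ipw n : ip (w n) (v n) = of_real k (q ^+ n * rnorm (v n)).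
  rewrite ipZl ipxx -rmorphM /=; congr of_real.
  by rewrite expr2 mulrA divfK// gt_eqF.
pose nxt n x := if q ^+ n * rnorm (v n) <= rnorm (ip (x + w n) (v n))
  then x + w n else x - w n.
have large n x : q ^+ n * rnorm (v n) <= rnorm (ip (nxt n x) (v n)).
  rewrite /nxt; case: ifPn => //; rewrite -ltNge => small.
  (* The values at [x + w n] and [x - w n] differ by [2 * ip (w n) (v n)], so if the first is below
     [q ^+ n * rnorm (v n)] in norm, the second exceeds it. *)
  have : rnorm (2 * ip (w n) (v n)) <=
      rnorm (ip (x + w n) (v n)) + rnorm (ip (x - w n) (v n)).
    have -> : 2 * ip (w n) (v n) = ip (x + w n) (v n) - ip (x - w n) (v n).
      by rewrite ipDl ipBl; ring.
    by rewrite -(rnormN (ip (x - _) _)) rnormD.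
  rewrite ipw -(rmorph_nat (of_real k) 2) -rmorphM /= rnorm_of_real; last first.
    by rewrite !mulr_ge0 ?exprn_ge0// ltW.
  by lra.
pose x := fix x n := if n is m.+1 then nxt m (x m) else 0 : H.
have step n : rnorm (x n.+1 - x n) <= 1 * q ^+ n.
  by rewrite mul1r /= /nxt; case: ifP => _; rewrite addrAC subrr add0r ?rnormN normw.
have [|l xl] := geometric_cvg _ step; first by rewrite q0.
have [C lC] := ptwise l.
(* The ratio is [q^-1 / 4]: combined with [4 ^+ n < rnorm (v n)], the growth estimate will give
   [1 <= 2 * C * (3 / 4) ^+ n], which this [n] violates. *)
have [|||n] := @geometric_small R (2 * C) (3 / 4) 1; [lra..|].
have /(_ n) growth : forall n, q ^+ n * rnorm (v n) <= 2 * rnorm (ip l (v n)).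
  move=> {}n; have := large n (x n).
  have := cauchy_schwarz (l - x n.+1) (v n).
  (* As [q] is one third, the steps after [n] add up to at most [q ^+ n.+1 / (1 - q) = q ^+ n / 2],
     so half of the value gained at step [n] survives at [l]. *)
  have : rnorm (l - x n.+1) * rnorm (v n) <= q ^+ n / 2 * rnorm (v n).
    rewrite ler_wpM2r ?(ltW (v0 n))//; apply: le_trans (xl n.+1) _.
    have q3 : 1 - q = q * 2 by rewrite /q; field.
    rewrite mul1r exprS q3 invfM mulrACA divff ?mul1r//.
    by rewrite invr_eq0.
  have : rnorm (ip (x n.+1) (v n)) <=
      rnorm (ip l (v n)) + rnorm (ip (l - x n.+1) (v n)).
    have -> : ip (x n.+1) (v n) = ip l (v n) - ip (l - x n.+1) (v n).
      by rewrite ipBl subKr.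
    by rewrite -(rnormN (ip (l - _) _)) rnormD.
  by rewrite -[nxt n (x n)]/(x n.+1); lra.
have [Fv v4] := vP n.
have : 1 <= 2 * C * (3 / 4) ^+ n.
  rewrite (_ : 3 / 4 = q^-1 / 4 :> R)//; last by rewrite invrK.
  rewrite expr_div_n mulrA ler_pdivlMr ?exprn_gt0// mul1r exprVn.
  rewrite ler_pdivlMr ?exprn_gt0//; last by rewrite invr_gt0.
  rewrite mulrC (le_trans _ (le_trans growth _))//.
    by rewrite ler_wpM2l ?exprn_ge0// ltW.
  by rewrite ler_wpM2l// lC.
by move=> /le_lt_trans h /h; rewrite ltxx.
Qed.

End InnerProduct.

(** * Sums over a frame *)

#[local] Existing Instance totally_filter.

Section PartialSums.
Variable I : choiceType.

Lemma partial_sumE (V : zmodType) (x : I -> V) (F : {fset I}) :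
  partial_sum x F = \sum_(i <- F) x i.
Proof. by rewrite /partial_sum big_seq_fsetE. Qed.

Lemma partial_sum_fsetD (V : zmodType) (x : I -> V) (F G : {fset I}) :
  (F `<=` G)%fset -> partial_sum x G = partial_sum x F + partial_sum x (G `\` F)%fset.
Proof.
move=> /fsubsetP FG; rewrite !partial_sumE (big_fsetID _ (mem F)) /=; congr (_ + _).
  by apply: eq_fbigl => i; rewrite !inE andb_idl//; exact: FG.
by apply: eq_fbigl => i; rewrite !inE andbC.
Qed.

Lemma partial_sum_ge0 (R : numDomainType) (a : I -> R) (F : {fset I}) :
  (forall i, 0 <= a i) -> 0 <= partial_sum a F.
Proof. by move=> a0; rewrite partial_sumE sumr_ge0. Qed.

Lemma ler_partial_sum (R : numDomainType) (a : I -> R) (F G : {fset I}) :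
  (forall i, 0 <= a i) -> (F `<=` G)%fset -> partial_sum a F <= partial_sum a G.
Proof. by move=> a0 FG; rewrite (partial_sum_fsetD _ FG) lerDl partial_sum_ge0. Qed.

Variable R : realType.
Implicit Type a : I -> R.

Lemma partial_sum_le_esum a (F : {fset I}) :
  ((partial_sum a F)%:E <= \esum_(i in [set: I]) (a i)%:E)%E.
Proof.
apply: esum_ge; exists [set` F]; first by split.
by rewrite fsbig_finite//= set_fsetK sumEFin partial_sumE.
Qed.

Lemma lt_esum_partial_sum a (b : R) : (b%:E < \esum_(i in [set: I]) (a i)%:E)%E ->
  exists F : {fset I}, b < partial_sum a F.
Proof.
move=> /ereal_sup_gt[_ [X [finX _] <-]].
rewrite fsbig_finite// sumEFin lte_fin => bX.
by exists (fset_set X); rewrite partial_sumE.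
Qed.

(** Take [F] whose sum is within [e] of the supremum of all partial sums; the sum over a larger [G]
    cannot pass that supremum. *)
Lemma partial_sum_tail a (b e : R) : (forall i, 0 <= a i) ->
  (forall F, partial_sum a F <= b) -> 0 < e ->
  exists F, forall G, (F `<=` G)%fset -> partial_sum a (G `\` F)%fset < e.
Proof.
move=> a0 ab e0; have ubb : ubound (range (partial_sum a)) b by move=> _ [F _ <-].
have hs : has_sup (range (partial_sum a)).
  by split; [exists (partial_sum a fset0%fset), fset0%fset|exists b].
have [_ [F _ <-] supF] := sup_adherent e0 hs.
exists F => G FG; have : partial_sum a G <= sup (range (partial_sum a)).
  by apply: ub_le_sup; [exists b|exists G].
by rewrite (partial_sum_fsetD a FG); lra.
Qed.

End PartialSums.

Section Limits.
Variables (R : realType) (k : scalar_kind).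
Local Notation K := (scalar_field R k).
Context {T : Type} {F : set_system T} {FF : ProperFilter F}.

(** Phrased for additive maps so that it also covers [conj_scalar], which is not linear over the
    complex numbers. *)
Lemma cvg_bounded_additive (V W : normedModType K) (phi : V -> W) (M : R)
    (u : T -> V) (l : V) :
  zmod_morphism phi -> (forall x, rnorm (phi x) <= M * rnorm x) ->
  u @ F --> l -> (phi \o u) @ F --> phi l.
Proof.
move=> phiB phiM /cvg_rnormP ul; apply/cvg_rnormP => e e0.
have M0 : 0 < `|M| + 1 by rewrite ltr_wpDl.
apply: filterS (ul _ (divr_gt0 e0 M0)) => t; rewrite ltr_pdivlMr// => lt.
rewrite /= -phiB (le_lt_trans (phiM _))//; apply: le_lt_trans lt.
by rewrite mulrC ler_wpM2l ?rnorm_ge0// (le_trans (ler_norm M))// lerDl.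
Qed.

Lemma rnorm_lim_le (V : normedModType K) (u : T -> V) (l : V) (b : R) :
  u @ F --> l -> (forall t, rnorm (u t) <= b) -> rnorm l <= b.
Proof.
move=> /cvg_rnormP ul ub; apply/ler_addgt0Pr => e e0.
have [t lt] := filter_ex (ul e e0).
rewrite -(subrK (u t) l) (le_trans (rnormD _ _))// addrC lerD//; exact: ltW.
Qed.

End Limits.

(** * Synthesis of square-summable coefficients under a Bessel bound *)

Section Frames.
Variables (R : realType) (k : scalar_kind).
Local Notation K := (scalar_field R k).
Variable H : completeNormedModType K.
Variable ip : {dot H for @conj_scalar R k}.
Hypothesis ip_norm : induces_norm ip.
Variables (I : countType) (f : I -> H).
Implicit Types (x y : H) (c : I -> K) (G : {fset I}).

Local Notation coefs x := (fun i => rnorm (ip x (f i)) ^+ 2).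

Section Bessel.
Variable B : R.
Hypothesis B0 : 0 < B.
Hypothesis bessel : forall x G, partial_sum (coefs x) G <= B * rnorm x ^+ 2.

Lemma ip_partial_suml c y G :
  ip (partial_sum (fun i => c i *: f i) G) y =
    partial_sum (fun i => c i * ip (f i) y) G.
Proof.
rewrite !partial_sumE linear_sumlz; apply: eq_bigr => i _; exact: ipZl.
Qed.

(** A self-improving estimate: with [v] the synthesised vector, [rnorm v ^+ 2] is the real part of
    the sum of [c i * ip (f i) v]. Weighted AM-GM bounds it by the mean of the right-hand side and a
    term that the Bessel bound keeps below [rnorm v ^+ 2]; that term is absorbed on the left. *)
Lemma synthesis_bound c G :
  rnorm (partial_sum (fun i => c i *: f i) G) ^+ 2 <=
    B * partial_sum (fun i => rnorm (c i) ^+ 2) G.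
Proof.
set v := partial_sum _ G.
have : rnorm v ^+ 2 <= (B * partial_sum (fun i => rnorm (c i) ^+ 2) G
    + B^-1 * partial_sum (coefs v) G) / 2.
  rewrite -[leLHS](of_realK k) -(ipxx ip_norm) {1}/v ip_partial_suml.
  rewrite !partial_sumE raddf_sum !mulr_sumr -big_split /= mulr_suml.
  apply: ler_sum => i _; apply: le_trans (ler_norm _) (le_trans (ler_re_rnorm _) _).
  rewrite rnormM (ipC ip (f i)) rnorm_conj.
  (* AM-GM: [s t <= (B s ^+ 2 + t ^+ 2 / B) / 2] *)
  move: (rnorm (c i)) (rnorm (ip v (f i))) => s t.
  rewrite -subr_ge0 (_ : _ - _ = B^-1 / 2 * (B * s - t) ^+ 2); last first.
    by field; rewrite gt_eqF.
  by rewrite mulr_ge0 ?sqr_ge0// divr_ge0 ?invr_ge0 ?ltW.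
have : B^-1 * partial_sum (coefs v) G <= rnorm v ^+ 2.
  by rewrite mulrC ler_pdivrMr// mulrC bessel.
by lra.
Qed.

(** Cauchy criterion: beyond a finite set the coefficients have small square sum, and
    [synthesis_bound] turns this into a small vector. *)
Lemma synthesis_cvg c (b : R) :
  (forall G, partial_sum (fun i => rnorm (c i) ^+ 2) G <= b) ->
  cvg (partial_sum (fun i => c i *: f i) @ totally).
Proof.
move=> cb; apply: rnorm_cvg => e e0.
have eB : 0 < e ^+ 2 / B by rewrite divr_gt0 ?exprn_gt0.
have [G tailG] := partial_sum_tail (fun i => sqr_ge0 (rnorm (c i))) cb eB.
exists (partial_sum (fun i => c i *: f i) G), G => // G' FG'.
rewrite (partial_sum_fsetD _ FG') opprD addrA subrr add0r rnormN.
rewrite -(@ltr_pXn2r _ 2)// ?nnegrE ?rnorm_ge0 ?(ltW e0)//.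
apply: le_lt_trans (synthesis_bound _ _) _.
by rewrite mulrC -ltr_pdivlMr//; exact: tailG.
Qed.

End Bessel.
End Frames.

(** * The frame operator, Riesz representation and existence of adjoints *)

Section FrameOperator.
Variables (R : realType) (k : scalar_kind).
Local Notation K := (scalar_field R k).
Variable H : completeNormedModType K.
Variable ip : {dot H for @conj_scalar R k}.
Hypothesis ip_norm : induces_norm ip.
Variables (I : countType) (f : I -> H) (A B : R).
Hypothesis f_frame : frame_bounds ip f A B.
Implicit Types (x y : H) (c : I -> K) (G : {fset I}).

Local Notation coefs x := (fun i => rnorm (ip x (f i)) ^+ 2).
Local Notation S := (frame_operator ip f).

Lemma frame_upper_gt0 : 0 < B.
Proof. by case: f_frame => A0 AB _; exact: lt_le_trans AB. Qed.

Lemma frame_bessel x G : partial_sum (coefs x) G <= B * rnorm x ^+ 2.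
Proof.
case: f_frame => _ _ /(_ x)/andP[_ xB]; rewrite -lee_fin.
exact: le_trans (partial_sum_le_esum _ _) xB.
Qed.

Lemma frame_lower x (e : R) : 0 < e ->
  exists G, A * rnorm x ^+ 2 - e < partial_sum (coefs x) G.
Proof.
case: f_frame => _ _ /(_ x)/andP[Ax _] e0; apply: lt_esum_partial_sum.
by apply: lt_le_trans Ax; rewrite lte_fin gtrBl.
Qed.

Lemma frame_operator_cvg : is_frame_operator ip f S.
Proof.
move=> x; have := frame_bessel x.
exact: (synthesis_cvg ip_norm frame_upper_gt0 frame_bessel).
Qed.

Lemma ip_cvg (u : {fset I} -> H) l y :
  u @ totally --> l -> (fun G => ip (u G) y) @ totally --> ip l y.
Proof.
apply: (cvg_bounded_additive (phi := ip^~ y) (M := rnorm y)) => [a b|x].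
  exact: ipBl.
by rewrite mulrC cauchy_schwarz.
Qed.

Lemma ip_frame_operator x y :
  partial_sum (fun i => ip x (f i) * ip (f i) y) @ totally --> ip (S x) y.
Proof.
have := ip_cvg (y := y) (@frame_operator_cvg x).
by under eq_fun do rewrite ip_partial_suml.
Qed.

Lemma conj_scalar_cvg (u : {fset I} -> K) l :
  u @ totally --> l -> (conj_scalar \o u) @ totally --> conj_scalar l.
Proof.
apply: (cvg_bounded_additive (M := 1)) => [|z]; last by rewrite rnorm_conj mul1r.
exact: conj_scalar_is_zmod_morphism.
Qed.

(** Conjugation exchanges the partial sums for the pair [x], [y] with those for [y], [x], and limits
    are unique. *)
Lemma frame_operator_sym x y : ip (S x) y = ip x (S y).
Proof.
rewrite [RHS]ipC; apply: (cvg_unique (@norm_hausdorff K K) (@ip_frame_operator x y)).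
have -> : partial_sum (fun i => ip x (f i) * ip (f i) y) =
    conj_scalar \o partial_sum (fun i => ip y (f i) * ip (f i) x).
  apply/funext => G /=; rewrite !partial_sumE rmorph_sum.
  by apply: eq_bigr => i _; rewrite rmorphM /= -!ipC mulrC.
exact: conj_scalar_cvg (@ip_frame_operator y x).
Qed.

Lemma frame_operator_linear : linear S.
Proof.
move=> a x y; apply: (cvg_unique (@norm_hausdorff K H) (@frame_operator_cvg _)).
have -> : partial_sum (fun i => ip (a *: x + y) (f i) *: f i) =
    a \*: partial_sum (fun i => ip x (f i) *: f i) +
    partial_sum (fun i => ip y (f i) *: f i).
  apply/funext => G; rewrite -[RHS]/(a *: partial_sum _ G + partial_sum _ G).
  rewrite !partial_sumE scaler_sumr -big_split /=.
  by apply: eq_bigr => i _; rewrite ipDl ipZl scalerDl scalerA.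
exact: cvgD (cvgZl_tmp (@frame_operator_cvg x)) (@frame_operator_cvg y).
Qed.

(** In the squared estimate one factor [B] comes from synthesis and one from the Bessel bound on the
    coefficients of [x]; the bound on finite sums passes to the limit. *)
Lemma frame_operator_bounded x : rnorm (S x) <= B * rnorm x.
Proof.
apply: (rnorm_lim_le (@frame_operator_cvg x)) => G.
have B0 := frame_upper_gt0; have nx := rnorm_ge0 x.
rewrite -(@ler_pXn2r _ 2)// ?nnegrE ?rnorm_ge0 ?mulr_ge0 ?(ltW B0)//.
apply: le_trans (synthesis_bound ip_norm B0 frame_bessel _ _) _.
by rewrite exprMn -mulrA ler_wpM2l ?frame_bessel// ltW.
Qed.

Lemma frame_operator_coercive x : A * rnorm x ^+ 2 <= re_scalar (ip (S x) x).
Proof.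
apply/ler_addgt0Pr => e e0; have e2 : 0 < e / 2 by rewrite divr_gt0.
have [G0 G0x] := frame_lower x e2.
have /cvg_rnormP /(_ _ e2) := @ip_frame_operator x x.
(* On the union both hold: the partial sum is within [e / 2] of [ip (S x) x], and it loses less than
   [e / 2] against the lower frame bound. *)
case=> G1 _ /(_ (G0 `|` G1)%fset (fsubsetUr _ _)).
set s := partial_sum _ _ => Gs.
have re_s : re_scalar s = partial_sum (coefs x) (G0 `|` G1)%fset.
  rewrite /s !partial_sumE raddf_sum; apply: eq_bigr => i _.
  by rewrite (ipC ip (f i)) -rnorm_sqr_scalar /= of_realK.
have := ler_partial_sum (fun i => sqr_ge0 (rnorm (ip x (f i)))) (fsubsetUl G0 G1).
have := le_trans (ler_norm _) (ler_re_rnorm (s - ip (S x) x)).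
rewrite -rnormN opprB raddfB /= re_s; lra.
Qed.

Lemma frame_operator_surj y : exists x, S x = y.
Proof.
pose Sl : {linear H -> H} :=
  HB.pack S (GRing.isLinear.Build _ _ _ _ S frame_operator_linear).
have A0 : 0 < A by case: f_frame.
exact: (lax_milgram ip_norm (T := Sl) A0 frame_operator_bounded
  frame_operator_coercive).
Qed.

(* The representing vector is [S^-1 (\sum_i conj (phi (f i)) *: f i)]. *)
Lemma riesz_frame (phi : {scalar H}) (M : R) :
  (forall x, rnorm (phi x) <= M * rnorm x) -> exists w, forall x, phi x = ip x w.
Proof.
move=> phiM; pose c i := conj_scalar (phi (f i)).
have B0 := frame_upper_gt0.
(* Testing [phi] on its own synthesised vector [v] gives [s <= M * rnorm v], while
   [rnorm v ^+ 2 <= B * s]; hence [s ^+ 2 <= M ^+ 2 * B * s], and a nonzero [s] cancels. *)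
have cB G : partial_sum (fun i => rnorm (c i) ^+ 2) G <= M ^+ 2 * B.
  set s := partial_sum _ G.
  have s0 : 0 <= s by apply: partial_sum_ge0 => i; exact: sqr_ge0.
  pose v := partial_sum (fun i => c i *: f i) G.
  have phiv : phi v = of_real k s.
    rewrite /v /s !partial_sumE linear_sum rmorph_sum; apply: eq_bigr => i _.
    by rewrite linearZ /= rnorm_sqr_scalar /c conj_scalarK.
  have sv : s <= M * rnorm v by rewrite -(rnorm_of_real k s0) -phiv phiM.
  have vs : rnorm v ^+ 2 <= B * s := synthesis_bound ip_norm B0 frame_bessel c G.
  have [->|s_neq0] := eqVneq s 0; first by rewrite mulr_ge0 ?sqr_ge0// ltW.
  have spos : 0 < s by rewrite lt_def s_neq0.
  rewrite -(ler_pM2r spos) -expr2 -mulrA.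
  apply: le_trans (ler_wpM2l (sqr_ge0 M) vs).
  by rewrite -exprMn ler_pXn2r// nnegrE (le_trans s0).
have := synthesis_cvg ip_norm B0 frame_bessel cB.
set z := lim _ => cz.
have phiS x : phi (S x) = ip x z.
  have phiB : zmod_morphism phi by move=> u v; rewrite linearB.
  have phiSx := cvg_bounded_additive (FF := totally_filter) phiB phiM
    (@frame_operator_cvg x).
  have phi_sum : phi \o partial_sum (fun i => ip x (f i) *: f i) =
      conj_scalar \o (fun G => ip (partial_sum (fun i => c i *: f i) G) x).
    apply/funext => G /=; rewrite ip_partial_suml !partial_sumE linear_sum rmorph_sum.
    apply: eq_bigr => i _.
    by rewrite linearZ rmorphM /= /c conj_scalarK -ipC mulrC.
  rewrite phi_sum in phiSx; rewrite ipC.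
  apply: (cvg_unique (@norm_hausdorff K K) phiSx).
  exact: conj_scalar_cvg (ip_cvg (y := x) cz).
(* With [z = S w] and [x = S x'], symmetry of [S] turns [ip x' z] into [ip x w]. *)
have [w wz] := frame_operator_surj z.
exists w => x; have [x' <-] := frame_operator_surj x.
by rewrite phiS -wz frame_operator_sym.
Qed.

(** The Riesz vector of [x |-> ip (T x) y] inhabits the set from which [adjoint] chooses, so the
    default value 0 is not what is returned. *)
Lemma adjointP (T : {linear H -> H}) (M : R) :
  (forall x, rnorm (T x) <= M * rnorm x) ->
  forall x y, ip (T x) y = ip x (adjoint ip T y).
Proof.
move=> TM x y; pose phi x := ip (T x) y.
have phi_lin : linear_for *%R phi.
  by move=> a u v; rewrite /phi linearP ipDl ipZl.
pose phiL : {scalar H} := HB.pack phi (GRing.isLinear.Build _ _ _ _ phi phi_lin).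
have [|w wP] := @riesz_frame phiL (M * rnorm y).
  move=> u; apply: le_trans (cauchy_schwarz ip_norm _ _) _.
  by rewrite mulrAC ler_wpM2r ?rnorm_ge0.
by apply: (@xgetPex _ 0 [set z | forall x, ip (T x) y = ip x z]); exists w.
Qed.

End FrameOperator.

(** * Bounded operators, adjoints and pseudo-inverses *)

Section BoundedOperators.
Variables (R : realType) (k : scalar_kind).
Local Notation K := (scalar_field R k).
Variable H : completeNormedModType K.

Lemma bounded_opP (T : H -> H) :
  bounded_op T <-> exists m : R, forall x, rnorm (T x) <= m * rnorm x.
Proof.
split=> -[m Tm].
  exists (re_scalar m) => x; have := ler_re_scalar (Tm x).
  by rewrite -(of_rnorm x) mulrC re_scalar_ofM mulrC.
exists (of_real k m) => x.
by rewrite -!of_rnorm -rmorphM /= ler_of_real.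
Qed.

Lemma le_opnorm (T : {linear H -> H}) : bounded_op T ->
  forall x, rnorm (T x) <= opnorm T * rnorm x.
Proof.
move=> /bounded_opP[m Tm] x.
have sup_ub z : rnorm z <= 1 -> rnorm (T z) <= opnorm T.
  move=> z1; apply: ub_le_sup; last first.
    exists z => //; rewrite /= -of_rnorm -(rmorph1 (of_real k)).
    by rewrite ler_of_real.
  exists `|m| => _ [u u1 <-]; apply: le_trans (Tm u) _.
  apply: le_trans (ler_wpM2r (rnorm_ge0 u) (ler_norm m)) _.
  rewrite ler_piMr// -(ler_of_real k) of_rnorm rmorph1; exact: u1.
have [->|x0] := eqVneq x 0; first by rewrite linear0 rnorm0 mulr0.
have nx : 0 < rnorm x by rewrite lt_def rnorm_eq0 x0 rnorm_ge0.
have nV : 0 <= (rnorm x)^-1 by rewrite invr_ge0 ltW.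
rewrite -ler_pdivrMr// mulrC.
have := sup_ub (of_real k (rnorm x)^-1 *: x).
by rewrite linearZ /= !rnormZ rnorm_of_real// mulVf ?gt_eqF//; apply.
Qed.

End BoundedOperators.

Lemma adjoint_linear (R : realType) (k : scalar_kind)
    (H : completeNormedModType (scalar_field R k))
    (ip : {dot H for @conj_scalar R k}) (T Ts : H -> H) :
  induces_norm ip -> (forall x y, ip (T x) y = ip x (Ts y)) -> linear Ts.
Proof.
move=> ip_norm TTs a x y; apply: (ip_injr ip_norm) => z.
by rewrite -TTs !ipDr !ipZr !TTs.
Qed.

(** * Adjoint pairs: surjectivity against lower bounds, and the pseudo-inverse *)

Section AdjointPair.
Variables (R : realType) (k : scalar_kind).
Local Notation K := (scalar_field R k).
Variable H : completeNormedModType K.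
Variable ip : {dot H for @conj_scalar R k}.
Hypothesis ip_norm : induces_norm ip.
Variables (T Ts : {linear H -> H}) (m : R).
Hypothesis Tm : forall x, rnorm (T x) <= m * rnorm x.
Hypothesis TTs : forall x y, ip (T x) y = ip x (Ts y).
Implicit Types x y z : H.

Lemma adjoint_sqr x : ip (T (Ts x)) x = of_real k (rnorm (Ts x) ^+ 2).
Proof. by rewrite TTs (ipxx ip_norm). Qed.

(** By Cauchy-Schwarz, [rnorm (Ts x) ^+ 2 = rnorm (ip (T (Ts x)) x) <= m * rnorm (Ts x) * rnorm x];
    divide by [rnorm (Ts x)] when it is nonzero. *)
Lemma adjoint_bounded x : rnorm (Ts x) <= m * rnorm x.
Proof.
have [Tx0|Tx0] := eqVneq (Ts x) 0.
  by have := le_trans (rnorm_ge0 _) (Tm x); rewrite Tx0 rnorm0.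
have nx : 0 < rnorm (Ts x) by rewrite lt_def rnorm_eq0 Tx0 rnorm_ge0.
rewrite -(ler_pM2l nx) -expr2 mulrA -[leLHS](rnorm_of_real k); last exact: sqr_ge0.
rewrite -adjoint_sqr; apply: le_trans (cauchy_schwarz ip_norm _ _) _.
by rewrite ler_wpM2r ?rnorm_ge0// mulrC Tm.
Qed.

(* Uniform boundedness of the functionals [ip^~ u] with [rnorm (Ts u) <= 1]:
   at [y = T z] they are bounded by [rnorm z]. *)
Lemma surj_adjoint_lower : (forall y, exists x, T x = y) ->
  exists2 c : R, 0 < c & forall x, c * rnorm x <= rnorm (Ts x).
Proof.
move=> Tsurj.
have [|C C1] := uniform_boundedness ip_norm (F := [set u | rnorm (Ts u) <= 1]).
  move=> y; have [z <-] := Tsurj y; exists (rnorm z) => u /= u1.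
  rewrite TTs (le_trans (cauchy_schwarz ip_norm _ _))//.
  by rewrite ler_piMr// rnorm_ge0.
have D0 : 0 < `|C| + 1 by rewrite ltr_wpDl.
exists (`|C| + 1)^-1 => [|x]; first by rewrite invr_gt0.
rewrite mulrC ler_pdivrMr//; apply/ler_addgt0Pr => e e0.
(* The extra term allows division by [s] even if [Ts x = 0], since injectivity of [Ts] is not yet
   known; it costs only [e] in the final bound. *)
pose s := rnorm (Ts x) + e / (`|C| + 1).
have s0 : 0 < s by rewrite ltr_wpDl ?rnorm_ge0// divr_gt0.
have sV : 0 <= s^-1 by rewrite invr_ge0 ltW.
have := C1 (of_real k s^-1 *: x).
rewrite /= linearZ !rnormZ rnorm_of_real// mulrC ler_pdivrMr// mul1r.
rewrite lerDl divr_ge0 ?(ltW e0) ?(ltW D0)// mulrC ler_pdivrMr// => /(_ isT) xC.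
have -> : rnorm (Ts x) * (`|C| + 1) + e = (`|C| + 1) * s.
  by rewrite /s; field; rewrite gt_eqF.
apply: le_trans xC _; rewrite ler_wpM2r ?(ltW s0)//.
by rewrite (le_trans (ler_norm C))// lerDl.
Qed.

Lemma adjoint_lower_coercive (c : R) : 0 < c ->
  (forall x, c * rnorm x <= rnorm (Ts x)) ->
  forall x, c ^+ 2 * rnorm x ^+ 2 <= re_scalar (ip (T (Ts x)) x).
Proof.
move=> c0 Tc x; rewrite adjoint_sqr of_realK -exprMn.
by rewrite ler_pXn2r// ?nnegrE ?rnorm_ge0// mulr_ge0 ?rnorm_ge0// ltW.
Qed.

Lemma adjoint_lower_surj (c : R) : 0 < c ->
  (forall x, c * rnorm x <= rnorm (Ts x)) ->
  forall y, exists z, T (Ts z) = y.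
Proof.
move=> c0 Tc.
apply: (lax_milgram ip_norm (T := T \o Ts) (M := `|m| * `|m|) (c := c ^+ 2)).
- by rewrite exprn_gt0.
- move=> x; apply: le_trans (Tm _) _; rewrite -mulrA.
  apply: le_trans (ler_wpM2r (rnorm_ge0 _) (ler_norm m)) _.
  rewrite ler_wpM2l//; apply: le_trans (adjoint_bounded _) _.
  by rewrite ler_wpM2r ?rnorm_ge0// ler_norm.
- exact: adjoint_lower_coercive.
Qed.

(* The pseudo-inverse is [T^* (T T^* )^-1]. *)
Lemma pseudo_inverse_surj : (forall y, exists x, T x = y) ->
  is_pseudo_inverse ip T (pseudo_inverse ip T).
Proof.
move=> Tsurj; apply: (@xgetPex _ (fun=> 0) [set P | is_pseudo_inverse ip T P]).
have [c c0 Tc] := surj_adjoint_lower Tsurj.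
have /choice[Q TQ] := adjoint_lower_surj c0 Tc.
(* Coercivity makes [T \o Ts] injective, so its right inverse [Q] is a two-sided inverse and
   inherits linearity. *)
have Ts_inj x y : T (Ts x) = T (Ts y) -> x = y.
  move=> xy; apply/eqP; rewrite -subr_eq0 -rnorm_eq0.
  have := adjoint_lower_coercive c0 Tc (x - y).
  have -> : T (Ts (x - y)) = 0 by rewrite !linearB xy subrr.
  rewrite linear0l raddf0 -exprMn => le0.
  have /eqP : (c * rnorm (x - y)) ^+ 2 = 0 by apply/le_anti; rewrite le0 sqr_ge0.
  by rewrite sqrf_eq0 mulf_eq0 gt_eqF.
have Q_linear : linear Q.
  by move=> a x y; apply: Ts_inj; rewrite TQ !linearP /= !TQ.
(* Coercivity at [Q y] reads [c ^+ 2 * rnorm (Q y) ^+ 2 <= re_scalar (ip y (Q y))]; Cauchy-Schwarz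
   and a division finish. *)
have Q_bounded y : rnorm (Q y) <= (c ^+ 2)^-1 * rnorm y.
  have := adjoint_lower_coercive c0 Tc (Q y); rewrite TQ => Qy.
  have [->|Q0] := eqVneq (Q y) 0.
    by rewrite rnorm0 mulr_ge0 ?rnorm_ge0// invr_ge0 sqr_ge0.
  have nQ : 0 < rnorm (Q y) by rewrite lt_def rnorm_eq0 Q0 rnorm_ge0.
  rewrite mulrC ler_pdivlMr ?exprn_gt0// -(ler_pM2r nQ).
  have := le_trans (ler_norm _) (ler_re_rnorm (ip y (Q y))).
  have := cauchy_schwarz ip_norm y (Q y); nra.
exists (Ts \o Q); split.
- by move=> a x y; rewrite /= Q_linear linearP.
- apply/bounded_opP; exists (`|m| * (c ^+ 2)^-1) => x /=.
  apply: le_trans (adjoint_bounded _) _; rewrite -mulrA.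
  apply: le_trans (ler_wpM2r (rnorm_ge0 _) (ler_norm m)) _.
  by rewrite ler_wpM2l.
- by move=> y _; exact: TQ.
- apply/seteqP; split=> y; rewrite /kernel_op /orthocompl /=.
    by move=> Py0 z _; rewrite -(TQ y) Py0 linear0 linear0l.
  move=> y_orth; have -> : y = 0.
    apply: (ip_injr ip_norm) => x; have [z <-] := Tsurj x.
    by rewrite ipC y_orth ?rmorph0 ?linear0r//; exists z.
  have -> : Q 0 = 0 by apply: Ts_inj; rewrite TQ !linear0.
  by rewrite linear0.
- apply/seteqP; split=> [_ [y _ <-] z Tz0 /=|x x_orth].
    by rewrite ipC -TTs Tz0 linear0l rmorph0.
  (* The difference [d] of [x] and its candidate preimage image [Ts (Q (T x))] lies in the kernel of
     [T]; both vectors are orthogonal to that kernel, so [d] is orthogonal to itself. *)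
  exists (T x) => //=; apply/eqP; rewrite eq_sym -subr_eq0; apply/eqP.
  set d := x - _; have Td0 : T d = 0 by rewrite linearB TQ subrr.
  have : ip d d = 0.
    by rewrite {2}/d ipBr -TTs Td0 linear0l subr0 ipC x_orth// rmorph0.
  move=> dd0; apply/eqP; rewrite -rnorm_eq0 -sqrf_eq0.
  by rewrite -(fmorph_eq0 (of_real k)) /= -(ipxx ip_norm) dd0.
Qed.

End AdjointPair.

(** * The transformed frame *)

Section TransformedFrame.
Variables (R : realType) (k : scalar_kind).
Local Notation K := (scalar_field R k).
Variable H : completeNormedModType K.
Variable ip : {dot H for @conj_scalar R k}.
Hypothesis ip_norm : induces_norm ip.
Variables (I : countType) (f : I -> H) (A B : R).
Hypothesis f_frame : frame_bounds ip f A B.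
Variables T Ts : {linear H -> H}.
Hypothesis T_bounded : bounded_op T.
Hypothesis TTs : forall x y, ip (T x) y = ip x (Ts y).
Local Notation g := (fun i => T (f i)).
Local Notation S := (frame_operator ip f).
Implicit Types x y : H.

Let Tm := le_opnorm T_bounded.

Lemma ip_transformed x i : ip x (T (f i)) = ip (Ts x) (f i).
Proof. by rewrite ipC TTs -ipC. Qed.

Lemma transformed_bounds x :
  ((A * rnorm (Ts x) ^+ 2)%:E
    <= \esum_(i in [set: I]) (rnorm (ip x (g i)) ^+ 2)%:E
    <= (B * rnorm (Ts x) ^+ 2)%:E)%E.
Proof.
under eq_esum do rewrite ip_transformed.
by case: f_frame => _ _; apply.
Qed.

Lemma transformed_upper x :
  (\esum_(i in [set: I]) (rnorm (ip x (g i)) ^+ 2)%:E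
    <= (B * opnorm T ^+ 2 * rnorm x ^+ 2)%:E)%E.
Proof.
have /andP[_ xB] := transformed_bounds x; apply: le_trans xB _.
have B0 := frame_upper_gt0 f_frame.
rewrite lee_fin -mulrA -exprMn ler_wpM2l ?(ltW B0)//.
have := adjoint_bounded ip_norm Tm TTs x => Tsx.
by rewrite ler_pXn2r// nnegrE ?(le_trans _ Tsx) ?rnorm_ge0.
Qed.

Lemma transformed_lower (c : R) : 0 < c ->
  (forall x, c * rnorm x <= rnorm (Ts x)) -> forall x,
  ((A * c ^+ 2 * rnorm x ^+ 2)%:E
    <= \esum_(i in [set: I]) (rnorm (ip x (g i)) ^+ 2)%:E)%E.
Proof.
move=> c0 Tc x; have /andP[Ax _] := transformed_bounds x; apply: le_trans Ax.
have A0 : 0 < A by case: f_frame.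
rewrite lee_fin -mulrA -exprMn ler_wpM2l ?(ltW A0)//.
by rewrite ler_pXn2r// nnegrE ?mulr_ge0 ?rnorm_ge0// ltW.
Qed.

Lemma transformed_frameP : is_frame ip g <-> (forall y, exists x, T x = y).
Proof.
have B0 := frame_upper_gt0 f_frame; have A0 : 0 < A by case: f_frame.
split=> [[A' [B' [A'0 _ g_frame]]] y|Tsurj].
  (* Comparing the new lower bound with the old upper bound at [Ts x] gives [A' * rnorm x ^+ 2 <= B
     * rnorm (Ts x) ^+ 2]. *)
  pose c := Num.sqrt (A' / B).
  have c0 : 0 < c by rewrite sqrtr_gt0 divr_gt0.
  have Tc x : c * rnorm x <= rnorm (Ts x).
    rewrite -(@ler_pXn2r _ 2)// ?nnegrE ?mulr_ge0 ?rnorm_ge0 ?(ltW c0)//.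
    rewrite exprMn sqr_sqrtr ?divr_ge0 ?(ltW A'0) ?(ltW B0)//.
    rewrite mulrAC ler_pdivrMr// [leRHS]mulrC.
    have /andP[A'x _] := g_frame x; have /andP[_ xB] := transformed_bounds x.
    by rewrite -lee_fin (le_trans A'x).
  have [z <-] := adjoint_lower_surj ip_norm Tm TTs c0 Tc y.
  by exists (Ts z).
have [c c0 Tc] := surj_adjoint_lower ip_norm TTs Tsurj.
(* The maximum secures the required order of the two bounds also in the zero space, where no vector
   would force it. *)
exists (A * c ^+ 2), (Num.max (A * c ^+ 2) (B * opnorm T ^+ 2)); split.
- by rewrite mulr_gt0 ?exprn_gt0.
- by rewrite le_max lexx.
- move=> x; rewrite transformed_lower//= (le_trans (transformed_upper x))//.
  by rewrite lee_fin ler_wpM2r ?sqr_ge0// le_max lexx orbT.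
Qed.

(** Continuity lets [T] act term by term on the convergent expansion of [S (Ts x)]. *)
Lemma transformed_frame_operator : is_frame_operator ip g (T \o S \o Ts).
Proof.
move=> x; have TB : zmod_morphism T by move=> u v; rewrite linearB.
have := cvg_bounded_additive (FF := totally_filter) TB Tm
  (@frame_operator_cvg _ _ _ _ ip_norm _ _ _ _ f_frame (Ts x)).
have -> // : T \o partial_sum (fun i => ip (Ts x) (f i) *: f i) =
   partial_sum (fun i => ip x (T (f i)) *: T (f i)).
apply/funext => G /=; rewrite !partial_sumE linear_sum.
by apply: eq_bigr => i _; rewrite linearZ ip_transformed.
Qed.

(** In the zero space the pseudo-inverse has norm 0, and with the convention that 0 inverts to 0 the
    lower bound would be 0, not positive. A nonzero vector makes the norm [p] positive, and
    evaluating both inequalities at it orders the two bounds. *)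
Lemma transformed_frame_bounds : (forall y, exists x, T x = y) ->
  (exists x : H, x != 0) ->
  frame_bounds ip g (A * opnorm (pseudo_inverse ip T) ^- 2) (B * opnorm T ^+ 2).
Proof.
move=> Tsurj [x0 x0_neq0].
have [P_lin P_bounded TP _ _] := pseudo_inverse_surj ip_norm Tm TTs Tsurj.
pose P : {linear H -> H} :=
  HB.pack (pseudo_inverse ip T) (GRing.isLinear.Build _ _ _ _ _ P_lin).
have {TP} TP x : T (P x) = x by apply: TP; have [z <-] := Tsurj x; exists z.
have Pp := le_opnorm (P_bounded : bounded_op P).
rewrite -[pseudo_inverse ip T]/(P : H -> H); set p := opnorm P in Pp *.
have nx0 : 0 < rnorm x0 by rewrite lt_def rnorm_eq0 x0_neq0 rnorm_ge0.
have p0 : 0 < p.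
  rewrite -(pmulr_lgt0 _ nx0) (lt_le_trans _ (Pp x0))// lt_def rnorm_ge0 andbT.
  rewrite rnorm_eq0; apply: contraNneq x0_neq0 => Px0.
  by rewrite -(TP x0) Px0 linear0.
have Tp x : p^-1 * rnorm x <= rnorm (Ts x).
  rewrite mulrC ler_pdivrMr//.
  have [->|x_neq0] := eqVneq x 0; first by rewrite linear0 !rnorm0 mul0r.
  have nx : 0 < rnorm x by rewrite lt_def rnorm_eq0 x_neq0 rnorm_ge0.
  rewrite -(ler_pM2r nx) -expr2 -[leLHS](rnorm_of_real k); last exact: sqr_ge0.
  rewrite -(ipxx ip_norm) -{1}(TP x) TTs.
  apply: le_trans (cauchy_schwarz ip_norm _ _) _.
  by rewrite mulrC -mulrA ler_wpM2l ?rnorm_ge0.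
have p0V : 0 < p^-1 by rewrite invr_gt0.
have bounds x : ((A * p ^- 2 * rnorm x ^+ 2)%:E
    <= \esum_(i in [set: I]) (rnorm (ip x (g i)) ^+ 2)%:E
    <= (B * opnorm T ^+ 2 * rnorm x ^+ 2)%:E)%E.
  by rewrite -exprVn transformed_lower// transformed_upper.
split=> //.
- by rewrite mulr_gt0 ?invr_gt0 ?exprn_gt0//; case: f_frame.
- have /andP[lo up] := bounds x0; have := le_trans lo up.
  by rewrite lee_fin ler_pM2r// exprn_gt0.
Qed.

End TransformedFrame.

Theorem corollary2p5 (R : realType) (k : scalar_kind)
  (H : completeNormedModType (scalar_field R k))
  (ip : {dot H for @conj_scalar R k}) (ip_norm : induces_norm ip)
  (H_separable : separable_space H)
  (I : countType) (f : I -> H) (A B : R) (f_frame : frame_bounds ip f A B)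
  (L : {linear H -> H}) (L_bounded : bounded_op L) :
  let S := frame_operator ip f in
  let Ls := adjoint ip L in
  let IdL : H -> H := fun x => x + L x in
  let IdLs : H -> H := fun x => x + Ls x in
  let g : I -> H := fun i => f i + L (f i) in
  [/\ is_frame ip g <-> (forall y, exists x, IdL x = y),
      (forall y, exists x, IdL x = y) ->
        is_frame_operator ip g (IdL \o S \o IdLs) /\
        ((exists x : H, x != 0) ->
          frame_bounds ip g (A * opnorm (pseudo_inverse ip IdL) ^- 2)
                            (B * opnorm IdL ^+ 2))
    & positive_op ip L \/ gt_negId ip L ->
        is_frame ip g /\
        is_frame_operator ip g
          (fun x => S x + L (S x) + S (Ls x) + L (S (Ls x)))].
Proof.
move=> S Ls IdL IdLs g.
have [m Lm] := (bounded_opP L).1 L_bounded.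
(* The given frame itself supplies the Riesz representation behind [Ls]. *)
have LLs : forall x y, ip (L x) y = ip x (Ls y) := adjointP ip_norm f_frame Lm.
have IdL_linear : linear IdL.
  by move=> a x y; rewrite /IdL linearP scalerDr addrACA.
have adjT x y : ip (IdL x) y = ip x (IdLs y) by rewrite ipDl ipDr LLs.
have IdLs_linear := adjoint_linear ip_norm adjT.
pose T : {linear H -> H} :=
  HB.pack IdL (GRing.isLinear.Build _ _ _ _ _ IdL_linear).
pose Ts : {linear H -> H} :=
  HB.pack IdLs (GRing.isLinear.Build _ _ _ _ _ IdLs_linear).
have T_bounded : bounded_op T.
  apply/bounded_opP; exists (1 + m) => x.
  by rewrite mulrDl mul1r (le_trans (rnormD _ _))// lerD.
have TTs : forall x y, ip (T x) y = ip x (Ts y) := adjT.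
have frameP := transformed_frameP ip_norm f_frame T_bounded TTs.
have frameop := transformed_frame_operator ip_norm f_frame T_bounded TTs.
split=> // [Tsurj|L_pos].
  split=> // nz; exact: (transformed_frame_bounds ip_norm f_frame T_bounded TTs).
split.
  apply/frameP.
  (* Either assumption makes [T] coercive, hence onto by Lax-Milgram: the constant is 1 for positive
     [L], and the real part of [e] otherwise. *)
  suff [c c0 Tc] : exists2 c : R, 0 < c &
      forall x, c * rnorm x ^+ 2 <= re_scalar (ip (T x) x).
    exact: (lax_milgram ip_norm (T := T) c0 (le_opnorm T_bounded) Tc).
  case: L_pos => [[_ _ L_ge0]|[_ [e [e0 Le]]]].
    exists 1 => // x; rewrite mul1r ipDl raddfD /= ipxx// of_realK lerDl.
    by have := ler_re_scalar (L_ge0 x); rewrite raddf0.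
  exists (re_scalar e) => [|x]; first exact: re_scalar_gt0.
  have := ler_re_scalar (Le x); rewrite -of_rnorm -rmorphXn /= mulrC re_scalar_ofM.
  by rewrite mulrC.
move=> x.
have SD u v : S (u + v) = S u + S v.
  by have := frame_operator_linear ip_norm f_frame 1 u v; rewrite !scale1r.
have <- : T (S (Ts x)) = S x + L (S x) + S (Ls x) + L (S (Ls x)).
  rewrite -[LHS]/(S (x + Ls x) + L (S (x + Ls x))) SD linearD.
  by rewrite addrACA !addrA.
exact: frameop.
Qed.
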